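(* Let $[b_1,b_2,\ldots,b_m]$ be an even continued fraction with $m\ge1$, and let $q=-t^{-1}$, $\overline q=-t$. Then the Jones polynomials of the associated oriented 2-bridge links satisfy $$V_{[b_1,\ldots,b_m]}=\begin{cases}t^{-|b_m|}\,V_{[b_1,\ldots,b_{m-2}]}-t^{-\frac12}\,[\,|b_m|\,]_q\,V_{[b_1,\ldots,b_{m-1}]}&\text{if the last entry of the type sequence of }[b_1,\ldots,b_m]\text{ is }-,\\[4pt] t^{|b_m|}\,V_{[b_1,\ldots,b_{m-2}]}-t^{\frac12}\,[\,|b_m|\,]_{\overline q}\,V_{[b_1,\ldots,b_{m-1}]}&\text{if the last entry of the type sequence of }[b_1,\ldots,b_m]\text{ is }+.\end{cases}$$ In particular, $$V_{[b_1]}=\begin{cases}t^{b_1}(-t^{-1/2}-t^{1/2})-t^{-\frac12}\,[-b_1]_q&\text{if }b_1<0,\\ t^{b_1}(-t^{-1/2}-t^{1/2})-t^{\frac12}\,[b_1]_{\overline q}&\text{if }b_1>0.\end{cases}$$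
   Context: An even continued fraction is $[b_1,\ldots,b_m]=b_1+1/(b_2+1/(\cdots+1/b_m))$ with all $b_i$ nonzero even integers. Its type sequence is $(\operatorname{sgn}(b_1),-\operatorname{sgn}(b_2),\ldots,(-1)^{m+1}\operatorname{sgn}(b_m))$. For a positive integer $b$, $[b]_q=1+q+\cdots+q^{b-1}$ and $[b]_{\overline q}=1+\overline q+\cdots+\overline q^{\,b-1}$. The link $C[b_1,\ldots,b_m]$ is the oriented 2-bridge link with Conway diagram consisting of $m$ successive 2-strand braids, the $i$-th having $|b_i|$ crossings; the diagram alternates from the $i$-th to the $(i+1)$-st braid iff $b_i,b_{i+1}$ have the same sign, and it is oriented so that all crossings of the $i$-th braid have sign $(-1)^{i+1}\operatorname{sgn}(b_i)$. Concretely: take four horizontal strands in positions $1,2,3,4$ and, from left to right, the braid $\sigma_2^{-b_1}\sigma_1^{b_2}\sigma_2^{-b_3}\cdots$ ($i$-th factor $\sigma_2^{-b_i}$ for $i$ odd, $\sigma_1^{b_i}$ for $i$ even), where $\sigma_j$ crosses the strands in positions $j,j+1$ by a crossing that is positive when both strands are oriented left to right. On the left join ends $1$–$2$ and $3$–$4$; on the right join $1$–$2$ and $3$–$4$ if $m$ is odd, and $2$–$3$ and $1$–$4$ (nested arcs) if $m$ is even. Since all $b_i$ are even the braid is pure; orient the strands with ends in positions $1,3$ left to right and those in positions $2,4$ right to left. Jones polynomial: $V(\text{unknot})=1$ and $t^{-1}V(L_+)-t\,V(L_-)+(t^{-1/2}-t^{1/2})V(L_0)=0$ for oriented links $L_+,L_-,L_0$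 that agree except near one point, where they have a positive crossing, a negative crossing, and the oriented smoothing respectively. $V_{[b_1,\ldots,b_m]}=V(C[b_1,\ldots,b_m])$. Conventions: $V_{[b_1,\ldots,b_0]}=V_{[\ ]}=1$ (unknot) and $V_{[b_1,\ldots,b_{-1}]}=V_{[0]}=-t^{-1/2}-t^{1/2}$ (two disjoint unknots). *)

(* Defs.v *)
From HB Require Import structures.
From mathcomp Require Import all_boot all_order all_algebra.
From Stdlib Require Import Relation_Operators.

Set Implicit Arguments.
Unset Strict Implicit.
Unset Printing Implicit Defensive.

Import Order.TTheory GRing.Theory Num.Theory.
Local Open Scope ring_scope.

(* Oriented link diagrams in Morse position, read from left to right as a     *)
(* word of slices.  The slice (i, p) places the piece p at the strands in     *)
(* positions i, i+1 (positions are counted from 0); all other strands go      *)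
(* straight through.                                                          *)
(*   Cup o   creates two adjacent strands joined at their left ends; the one  *)
(*           in position i is oriented left to right iff o = true             *)
(*   Cap     joins two adjacent, oppositely oriented strands at their right   *)
(*           ends                                                             *)
(*   Cross s is a crossing; Cross true is the one that is positive when both  *)
(*           strands are oriented left to right.  The boolean s describes the *)
(*           unoriented crossing; its sign depends on the orientations, see   *)
(*           skein_triple.                                                    *)
Inductive piece := Cup of bool | Cap | Cross of bool.

Definition slice := (nat * piece)%type.
Definition diagram := seq slice.

Definition nin (p : piece) : nat := if p is Cup _ then 0%N else 2%N.
Definition nout (p : piece) : nat := if p is Cap then 0%N else 2%N.

(* A state lists the orientations (true = left to right) of the strands met   *)
(* by a vertical line; step and run return None on ill-formed words.          *)
Definition step (st : seq bool) (x : slice) : option (seq bool) :=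
  let: (i, p) := x in
  match p with
  | Cup o => if (i <= size st)%N
             then Some (take i st ++ o :: ~~ o :: drop i st) else None
  | Cap => if drop i st is a :: b :: r then
             if a == ~~ b then Some (take i st ++ r) else None
           else None
  | Cross _ => if drop i st is a :: b :: r
               then Some (take i st ++ b :: a :: r) else None
  end.

Fixpoint run (st : seq bool) (D : diagram) : option (seq bool) :=
  if D is x :: D' then
    if step st x is Some st' then run st' D' else None
  else Some st.

Definition is_link (D : diagram) : bool := run [::] D == Some [::].

(* Local moves: two link diagrams in Morse position represent isotopic        *)
(* oriented links iff they are related by a finite sequence of these moves    *)
(* (Freyd-Yetter, Turaev, Kauffman).  In move_far, the slices are far apart.  *)
Inductive local_move : diagram -> diagram -> Prop :=
| move_far i k p p' :
    local_move [:: (i, p); (i + nout p + k, p')%N]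
               [:: (i + nin p + k, p')%N; (i, p)]
| move_zigzag i o : local_move [:: (i, Cup o); (i.+1, Cap)] [::]
| move_zagzig i o : local_move [:: (i.+1, Cup o); (i, Cap)] [::]
| move_R1_cup i o s :
    local_move [:: (i, Cup o); (i, Cross s)] [:: (i, Cup (~~ o))]
| move_R1_cap i s : local_move [:: (i, Cross s); (i, Cap)] [:: (i, Cap)]
| move_R2 i s : local_move [:: (i, Cross s); (i, Cross (~~ s))] [::]
| move_R3 i s :
    local_move [:: (i, Cross s); (i.+1, Cross s); (i, Cross s)]
               [:: (i.+1, Cross s); (i, Cross s); (i.+1, Cross s)]
| move_slide_cup i o s :
    local_move [:: (i, Cup o); (i.+1, Cross s)]
               [:: (i.+1, Cup o); (i, Cross (~~ s))]
| move_slide_cap i s :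
    local_move [:: (i, Cross s); (i.+1, Cap)]
               [:: (i.+1, Cross (~~ s)); (i, Cap)].

Inductive link_move : diagram -> diagram -> Prop :=
| LinkMove u l r v of local_move l r
    & is_link (u ++ l ++ v) & is_link (u ++ r ++ v) :
    link_move (u ++ l ++ v) (u ++ r ++ v).

Definition isotopic : diagram -> diagram -> Prop :=
  clos_refl_sym_trans diagram link_move.

(* skein_triple L+ L- L0.  Rotating one strand by a half-turn changes the     *)
(* sign of a crossing, so an antiparallel Cross true is negative; the         *)
(* oriented smoothing of an antiparallel crossing is a cap followed by a cup. *)
Inductive skein_triple : diagram -> diagram -> diagram -> Prop :=
| skein_parallel u v i a st r of run [::] u = Some st
    & drop i st = a :: a :: r :
    skein_triple (u ++ (i, Cross true) :: v) (u ++ (i, Cross false) :: v)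
                 (u ++ v)
| skein_antiparallel u v i a st r of run [::] u = Some st
    & drop i st = a :: ~~ a :: r :
    skein_triple (u ++ (i, Cross false) :: v) (u ++ (i, Cross true) :: v)
                 (u ++ (i, Cap) :: (i, Cup (~~ a)) :: v).

(* The fraction field of Z[t^(1/2)], which contains Z[t^(1/2), t^(-1/2)].     *)
Notation coef := {fraction {poly int}}.

Definition sqrt_t : coef := tofrac 'X.
Definition t : coef := sqrt_t ^+ 2.

Definition unknot : diagram := [:: (0%N, Cup true); (0%N, Cap)].

Record is_jones (V : diagram -> coef) : Prop := IsJones {
  jones_isotopic : forall D D', is_link D -> is_link D' ->
    isotopic D D' -> V D = V D';
  jones_unknot : V unknot = 1;
  jones_skein : forall Lp Lm L0,
    is_link Lp -> is_link Lm -> is_link L0 -> skein_triple Lp Lm L0 ->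
    t^-1 * V Lp - t * V Lm + (sqrt_t^-1 - sqrt_t) * V L0 = 0
}.

Definition even_cf (b : seq int) : bool :=
  all (fun x => (x != 0) && (2 %| x)%Z) b.

(* Entries are indexed from 0, so b`_k is b_(k+1).                            *)
Definition type_seq (b : seq int) : seq int :=
  mkseq (fun k => (-1) ^+ k * sgz b`_k) (size b).

(* sigma j e is the e-th power of the crossing of positions j, j+1 (from 0).  *)
Definition sigma (j : nat) (e : int) : diagram :=
  nseq `|e|%N (j, Cross (0 <= e)).

Definition braid (b : seq int) : diagram :=
  flatten (mkseq (fun k => if odd k then sigma 0 b`_k else sigma 1 (- b`_k))
                 (size b)).

Definition two_bridge (b : seq int) : diagram :=
  [:: (0%N, Cup true); (2%N, Cup true)] ++ braid b ++
  (if odd (size b) then [:: (0%N, Cap); (0%N, Cap)]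
   else [:: (1%N, Cap); (0%N, Cap)]).

(* V_[b_1, ..., b_k], with the conventions for k = 0 and k = -1.              *)
Definition Vcf (V : diagram -> coef) (b : seq int) (k : int) : coef :=
  match k with
  | Posz 0 => 1
  | Posz n => V (two_bridge (take n b))
  | Negz _ => - sqrt_t^-1 - sqrt_t
  end.

Definition q : coef := - t^-1.
Definition qbar : coef := - t.

(* [b]_x = 1 + x + ... + x^(b-1), used for positive b only.                   *)
Definition qint (x : coef) (b : int) : coef := \sum_(i < `|b|%N) x ^+ i.

(* Main.v *)
Require Import Defs.
From HB Require Import structures.
From mathcomp Require Import all_boot all_order all_algebra.
From mathcomp Require Import ring zify.
From Stdlib Require Import Relation_Operators.

Set Implicit Arguments.
Unset Strict Implicit.
Unset Printing Implicit Defensive.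

Import Order.TTheory GRing.Theory Num.Theory.
Local Open Scope ring_scope.

(** In the last braid the two strands are antiparallel, so the oriented
    smoothing of its first crossing is a cap followed by a cup: the remaining
    crossings unwind into the cup by Reidemeister I, and straightening the strand
    leaves the link of the fraction with its last entry deleted.  Switching the
    first crossing cancels it with the next one.  The skein relation hence lowers
    [|b_m|] by two, and summing this recursion gives the coefficients.  With no
    crossing left, the braid before the last one abuts the caps and unwinds,
    which leaves the link of the fraction with its last two entries deleted. *)

(** * Strand orientations along a word of slices *)

Lemma run_cat (u v : diagram) (st : seq bool) :
  run st (u ++ v) = obind (run^~ v) (run st u).
Proof. by elim: u st => //= x u IH st; case: (step st x). Qed.

Lemma is_link_cat (u v : diagram) (st : seq bool) :
  run [::] u = Some st -> is_link (u ++ v) = (run st v == Some [::]).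
Proof. by move=> ru; rewrite /is_link run_cat ru. Qed.

Lemma run_cross (x r : seq bool) (a b s : bool) (D : diagram) :
  run (x ++ a :: b :: r) ((size x, Cross s) :: D) = run (x ++ b :: a :: r) D.
Proof. by rewrite /= drop_size_cat // take_size_cat. Qed.

Lemma run_cap (x r : seq bool) (a b : bool) (D : diagram) : a == ~~ b ->
  run (x ++ a :: b :: r) ((size x, Cap) :: D) = run (x ++ r) D.
Proof. by move=> ab; rewrite /= drop_size_cat // take_size_cat // ab. Qed.

Lemma run_cup (x r : seq bool) (o : bool) (D : diagram) :
  run (x ++ r) ((size x, Cup o) :: D) = run (x ++ o :: ~~ o :: r) D.
Proof.
by rewrite /= size_cat leq_addr drop_size_cat // take_size_cat.
Qed.

Lemma run_crosses (x r : seq bool) (a s : bool) (n : nat) :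
  run (x ++ a :: ~~ a :: r) (nseq n (size x, Cross s))
  = Some (x ++ (a (+) odd n) :: ~~ (a (+) odd n) :: r).
Proof.
elim: n a => [|n IH] a; first by rewrite addbF.
rewrite [nseq _ _]/= run_cross -{2}(negbK a) IH /=.
by case: a; case: (odd n).
Qed.

(** * Solving the recursion and the skein relation in a field *)

(** The term [c * (1 - p) * l] supplies the first two terms of the geometric sum in [- p]; the
    factor [p ^+ 2 = (- p) ^+ 2] shifts the earlier sum by two. *)
Lemma twist_sum (F : fieldType) (p c l : F) (w : nat -> F) :
  (forall n, ~~ odd n -> w n.+2 = p ^+ 2 * w n - c * (1 - p) * l) ->
  forall n, ~~ odd n ->
    w n = p ^+ n * w 0%N - c * (\sum_(i < n) (- p) ^+ i) * l.
Proof.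
move=> rec n n_even; rewrite -(even_halfK n_even).
elim: n./2 => [|k IH]; first by rewrite big_ord0 mulr0 mul0r subr0 mul1r.
rewrite doubleS rec ?odd_double // IH !big_ord_recl /=.
have -> : \sum_(i < k.*2) (- p) ^+ bump 0 (bump 0 i)
          = p ^+ 2 * \sum_(i < k.*2) (- p) ^+ i.
  by rewrite mulr_sumr; apply: eq_bigr => i _; rewrite !exprS; ring.
rewrite !exprS expr0; ring.
Qed.

(** Both crossings are solved for, because a twist may have either sign; [z] stands for [sqrt_t]. *)
Lemma skein_solve (F : fieldType) (z p m l : F) : z != 0 ->
  (z ^+ 2)^-1 * p - z ^+ 2 * m + (z^-1 - z) * l = 0 ->
  p = (z ^+ 2) ^+ 2 * m - z * (1 - z ^+ 2) * l /\
  m = (z ^+ 2)^-1 ^+ 2 * p - z^-1 * (1 - (z ^+ 2)^-1) * l.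
Proof.
move=> z0 h.
have e1 : p - ((z ^+ 2) ^+ 2 * m - z * (1 - z ^+ 2) * l)
  = z ^+ 2 * ((z ^+ 2)^-1 * p - z ^+ 2 * m + (z^-1 - z) * l) by field.
have e2 : m - ((z ^+ 2)^-1 ^+ 2 * p - z^-1 * (1 - (z ^+ 2)^-1) * l)
  = - (z ^+ 2)^-1 * ((z ^+ 2)^-1 * p - z ^+ 2 * m + (z^-1 - z) * l) by field.
by split; apply/eqP; rewrite -subr_eq0 ?e1 ?e2 h mulr0.
Qed.

(** [z ^+ 2 != 1] permits division by the coefficient [z^-1 - z] of the smoothing; the two 1s are
    the values of the curls. *)
Lemma unlink_solve (F : fieldType) (z l : F) : z != 0 -> z ^+ 2 != 1 ->
  (z ^+ 2)^-1 * 1 - z ^+ 2 * 1 + (z^-1 - z) * l = 0 -> l = - z^-1 - z.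
Proof.
move=> z0 z1 h; apply/eqP; rewrite -subr_eq0.
have z1' : 1 - z ^+ 2 != 0 by rewrite subr_eq0 eq_sym.
have -> : l - (- z^-1 - z)
  = z / (1 - z ^+ 2) * ((z ^+ 2)^-1 * 1 - z ^+ 2 * 1 + (z^-1 - z) * l).
  by field; rewrite z0 z1'.
by rewrite h mulr0.
Qed.

Lemma sqrt_t_neq0 : sqrt_t != 0.
Proof. by rewrite tofrac_eq0 polyX_eq0. Qed.

Lemma t_neq1 : sqrt_t ^+ 2 != 1.
Proof.
rewrite /sqrt_t -tofracXn -tofrac1 tofrac_eq; apply/eqP => /(congr1 (size \o val)) /=.
by rewrite size_polyXn size_poly1.
Qed.

(** * Two-bridge diagrams cut into cups, twists and a closing *)

Definition state0 : seq bool := [:: true; false; true; false].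
Definition cups : diagram := [:: (0%N, Cup true); (2%N, Cup true)].
(** [k] is the parity of the number of earlier braids. The twist sits at position [~~ k], where
    [closing k] has its first cap; a diagram ending with this twist is closed by
    [closing (~~ k)]. *)
Definition twist (k : bool) (x : int) : diagram :=
  if k then sigma 0 x else sigma 1 (- x).
Definition closing (k : bool) : diagram :=
  if k then [:: (0%N, Cap); (0%N, Cap)] else [:: (1%N, Cap); (0%N, Cap)].

Lemma braid_rcons (b : seq int) (x : int) :
  braid (rcons b x) = braid b ++ twist (odd (size b)) x.
Proof.
rewrite /braid size_rcons /mkseq -[X in iota 0 X]addn1 iotaD map_cat flatten_cat.
congr (_ ++ _); last by rewrite /= cats0 nth_rcons ltnn eqxx.
congr flatten; apply/eq_in_map => i; rewrite mem_iota add0n => /= lt_i.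
by rewrite nth_rcons lt_i.
Qed.

Lemma two_bridgeE (b : seq int) :
  two_bridge b = (cups ++ braid b) ++ closing (odd (size b)).
Proof. by rewrite -catA. Qed.

Lemma twistE (k : bool) (x : int) :
  twist k x = nseq `|x|%N ((~~ k : nat), Cross (0 <= if k then x else - x)).
Proof. by case: k => //; rewrite /twist /sigma abszN. Qed.

Lemma even_entry (x : int) : (2 %| x)%Z -> ~~ odd `|x|%N.
Proof. by rewrite -dvdn2; case: x. Qed.

Lemma even_cf_rcons (b : seq int) (x : int) :
  even_cf (rcons b x) -> [/\ even_cf b, x != 0 & ~~ odd `|x|%N].
Proof.
by rewrite /even_cf all_rcons => /andP[/andP[x0 /even_entry x2] ?].
Qed.

(** Even twists are pure, so each returns the strands to [state0], where neighbours are
    antiparallel. *)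
Lemma run_braid (b : seq int) :
  even_cf b -> run [::] (cups ++ braid b) = Some state0.
Proof.
elim/last_ind: b => // b x IH /even_cf_rcons[/IH rb _ x2].
rewrite braid_rcons catA run_cat rb /= twistE; case: (odd _) => /=.
  by rewrite (@run_crosses [::] [:: true; false]) (negbTE x2).
by rewrite (@run_crosses [:: true] [:: false] false) (negbTE x2).
Qed.

(** * Local moves, twists and the two-component unlink *)

Section Jones.
Variables (V : diagram -> coef) (hV : is_jones V).

Lemma jones_local (u l r v : diagram) (st : seq bool) :
  local_move l r -> run [::] u = Some st -> run st l = run st r ->
  is_link (u ++ r ++ v) -> V (u ++ l ++ v) = V (u ++ r ++ v).
Proof.
move=> lr ru elr Lr.
have Ll : is_link (u ++ l ++ v).
  by move: Lr; rewrite !(is_link_cat _ ru) !run_cat elr.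
apply: (jones_isotopic hV) => //; apply: rst_step; exact: LinkMove.
Qed.

(** Each Reidemeister I move at the cup reverses its recorded orientation, whence the parity of
    [n]. *)
Lemma unwind_cup (u v : diagram) (x r : seq bool) (o s : bool) (n : nat) :
  run [::] u = Some (x ++ r) ->
  is_link (u ++ (size x, Cup (o (+) odd n)) :: v) ->
  V (u ++ (size x, Cup o) :: nseq n (size x, Cross s) ++ v)
  = V (u ++ (size x, Cup (o (+) odd n)) :: v).
Proof.
move=> ru; elim: n o => [|n IH] o; first by rewrite addbF.
rewrite /= addbN -addNb => Lv; rewrite -[RHS]IH //.
have:= @jones_local u [:: (size x, Cup o); (size x, Cross s)]
  [:: (size x, Cup (~~ o))] (nseq n (size x, Cross s) ++ v) (x ++ r).
apply=> //; first exact: move_R1_cup.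
  by rewrite !run_cup run_cross negbK.
rewrite (is_link_cat _ ru) run_cup run_cat run_crosses.
by move: Lv; rewrite (is_link_cat _ ru) run_cup.
Qed.

(** Crossings are removed from the right, where they meet the cap; a cap records no orientation, so
    no parity appears. *)
Lemma unwind_cap (u v : diagram) (x r : seq bool) (a s : bool) (n : nat) :
  run [::] u = Some (x ++ a :: ~~ a :: r) ->
  is_link (u ++ (size x, Cap) :: v) ->
  V (u ++ nseq n (size x, Cross s) ++ (size x, Cap) :: v)
  = V (u ++ (size x, Cap) :: v).
Proof.
move=> ru Lv; elim: n => // n IH.
rewrite -[RHS]IH -[n.+1]addn1 nseqD /= -!catA [LHS]/= 2![u ++ _ ++ _]catA.
set st := x ++ (a (+) odd n) :: ~~ (a (+) odd n) :: r.
have ru' : run [::] (u ++ nseq n (size x, Cross s)) = Some st.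
  by rewrite run_cat ru /= run_crosses.
apply: (@jones_local _ [:: (size x, Cross s); (size x, Cap)]
  [:: (size x, Cap)] v st) => //.
- exact: move_R1_cap.
- by rewrite run_cross !run_cap ?negbK.
- rewrite (is_link_cat _ ru') run_cap ?negbK //.
  by move: Lv; rewrite (is_link_cat _ ru) run_cap ?negbK.
Qed.

(** Between antiparallel strands [Cross true] is negative, which fixes [p] and [c]. *)
Lemma jones_twist (u v : diagram) (x r : seq bool) (a s : bool) (n : nat) :
  let p := if s then t^-1 else t in
  let c := if s then sqrt_t^-1 else sqrt_t in
  run [::] u = Some (x ++ a :: ~~ a :: r) -> is_link (u ++ v) -> ~~ odd n ->
  V (u ++ nseq n (size x, Cross s) ++ v)
  = p ^+ n * V (u ++ v)
    - c * (\sum_(i < n) (- p) ^+ i)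
      * V (u ++ (size x, Cap) :: (size x, Cup a) :: v).
Proof.
move=> p c ru Lv; pose w m := V (u ++ nseq m (size x, Cross s) ++ v).
move: n; apply: (@twist_sum _ p c _ w) => n n_even.
have Lsucc b : is_link (u ++ (size x, Cross b) :: nseq n.+1 (size x, Cross s) ++ v).
  rewrite (is_link_cat _ ru) run_cross -{2}(negbK a) run_cat run_crosses /=.
  by rewrite (negbTE n_even) addbT negbK -(is_link_cat _ ru).
have Lcup : is_link (u ++ (size x, Cap) :: (size x, Cup a) :: v).
  by move: Lv; rewrite !(is_link_cat _ ru) run_cap ?negbK // run_cup.
have ru' : run [::] (u ++ [:: (size x, Cap)]) = Some (x ++ r).
  by rewrite run_cat ru [LHS]run_cap ?negbK.
have rcup b w1 : run [::] (u ++ (size x, Cap) :: (size x, Cup b) :: w1)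
    = run (x ++ b :: ~~ b :: r) w1.
  by rewrite run_cat ru [LHS]run_cap ?negbK // run_cup.
(* A crossing swaps the strands, so the smoothing creates [Cup (~~ a)]; the odd number [n.+1] of
   remaining crossings turns it back to [Cup a]. *)
have Lsmooth : is_link (u ++ (size x, Cap) :: (size x, Cup (~~ a))
    :: nseq n.+1 (size x, Cross s) ++ v).
  rewrite /is_link rcup run_cat run_crosses /=.
  by rewrite (negbTE n_even) addbT negbK -(is_link_cat _ ru).
have smooth : V (u ++ (size x, Cap) :: (size x, Cup (~~ a))
      :: nseq n.+1 (size x, Cross s) ++ v)
    = V (u ++ (size x, Cap) :: (size x, Cup a) :: v).
  have := @unwind_cup _ v _ _ (~~ a) s n.+1 ru'.
  rewrite [odd n.+1]/= n_even addbT negbK -!catA; exact.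
have switch : V (u ++ (size x, Cross (~~ s)) :: nseq n.+1 (size x, Cross s) ++ v)
    = w n.
  apply: (@jones_local u [:: (size x, Cross (~~ s)); (size x, Cross s)] [::]
    _ _ _ ru).
  - by rewrite -{2}[s]negbK; apply: move_R2.
  - by rewrite !run_cross.
  - rewrite (is_link_cat _ ru) cat0s run_cat run_crosses (negbTE n_even) addbF.
    by rewrite -(is_link_cat _ ru).
have skein := skein_antiparallel (nseq n.+1 (size x, Cross s) ++ v) ru
  (drop_size_cat _ erefl).
have {skein} := jones_skein hV (Lsucc _) (Lsucc _) Lsmooth skein.
rewrite smooth => /(skein_solve sqrt_t_neq0)[h1 h2].
(* For [s] true the longer twist is the negative diagram, giving [h2]; otherwise it is the positive
   one, giving [h1]. *)
by rewrite -switch /w /p /c; clear -h1 h2; case: s h1 h2.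
Qed.

(* Both resolutions of a curl of the unknot are unknots, and its oriented
   smoothing consists of two circles. *)
Lemma jones_unlink : V (cups ++ closing true) = - sqrt_t^-1 - sqrt_t.
Proof.
have curl s : V [:: (0%N, Cup true); (0%N, Cross s); (0%N, Cap)] = 1.
  rewrite -(jones_unknot hV).
  by apply: (@jones_local [:: (0%N, Cup true)] [:: (0%N, Cross s); (0%N, Cap)]
    [:: (0%N, Cap)] [::] [:: true; false]) => //; apply: move_R1_cap.
pose OO o := [:: (0%N, Cup true); (0%N, Cap); (0%N, Cup o); (0%N, Cap)].
(* A curl on the second circle can be absorbed by its cup, which reverses the cup, or by its cap,
   which does not. *)
have flip : V (OO false) = V (OO true).
  transitivity (V [:: (0%N, Cup true); (0%N, Cap); (0%N, Cup true);
                      (0%N, Cross true); (0%N, Cap)]).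
    symmetry; apply: (@jones_local [:: (0%N, Cup true); (0%N, Cap)]
      [:: (0%N, Cup true); (0%N, Cross true)] [:: (0%N, Cup false)]
      [:: (0%N, Cap)] [::]) => //; exact: move_R1_cup.
  by apply: (@jones_local [:: (0%N, Cup true); (0%N, Cap); (0%N, Cup true)]
    [:: (0%N, Cross true); (0%N, Cap)] [:: (0%N, Cap)] [::]
    [:: true; false]) => //; apply: move_R1_cap.
have side : V (OO true) = V (cups ++ closing true).
  apply: (@jones_local [:: (0%N, Cup true)] [:: (0%N, Cap); (0%N, Cup true)]
    [:: (2%N, Cup true); (0%N, Cap)] [:: (0%N, Cap)] [:: true; false]) => //.
  exact: (move_far 0 0 Cap (Cup true)).
have := jones_skein hV _ _ _ (@skein_antiparallel [:: (0%N, Cup true)]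
  [:: (0%N, Cap)] 0 true [:: true; false] [::] erefl erefl).
rewrite !curl -/(OO false) flip side => /(_ erefl erefl erefl).
exact: unlink_solve sqrt_t_neq0 t_neq1.
Qed.

Lemma jones_empty : V (two_bridge [::]) = 1.
Proof.
rewrite -(jones_unknot hV).
apply: (@jones_local [:: (0%N, Cup true)] [:: (2%N, Cup true); (1%N, Cap)]
  [::] [:: (0%N, Cap)] [:: true; false]) => //.
exact: move_zagzig.
Qed.

(** * The links left after resolving the last twist *)

(** The new cup and the first cap of [closing (~~ k)] form a zigzag; once it is straightened, the
    smoothing's cap starts [closing k]. *)
Lemma jones_smoothed (b : seq int) : even_cf b ->
  let k := odd (size b) in
  V ((cups ++ braid b) ++
     (~~ k : nat, Cap) :: (~~ k : nat, Cup k) :: closing (~~ k))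
  = V (two_bridge b).
Proof.
move=> /run_braid rb k; rewrite two_bridgeE -/k.
move: (cups ++ braid b) rb => u ru; case: k; rewrite -!(cat_rcons _ u) -cats1.
  apply: (@jones_local _ [:: (0%N, Cup true); (1%N, Cap)] [::] [:: (0%N, Cap)]
    [:: true; false]) => //; first exact: move_zigzag.
    by rewrite run_cat ru.
  by rewrite /is_link !run_cat ru.
apply: (@jones_local _ [:: (1%N, Cup false); (0%N, Cap)] [::] [:: (0%N, Cap)]
  [:: true; false]) => //; first exact: move_zagzig.
  by rewrite run_cat ru.
by rewrite /is_link !run_cat ru.
Qed.

(** This closing belongs to one further, now empty, twist; its first cap lies at the position of the
    twist of [x], which unwinds into it. *)
Lemma jones_untwisted (b : seq int) (x : int) : even_cf (rcons b x) ->
  V ((cups ++ braid (rcons b x)) ++ closing (odd (size b)))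
  = V (two_bridge b).
Proof.
move=> /even_cf_rcons[/run_braid rb _ x2].
rewrite two_bridgeE braid_rcons catA -catA twistE.
move: (cups ++ braid b) rb => u ru; case: (odd _).
  apply: (@unwind_cap u _ [::] [:: true; false] true) => //.
  by rewrite (is_link_cat _ ru).
apply: (@unwind_cap u _ [:: true] [:: false] false) => //.
by rewrite (is_link_cat _ ru).
Qed.

Lemma jones_two_bridge_rcons (b : seq int) (x : int) : even_cf (rcons b x) ->
  let s := 0 < (-1) ^+ size b * x in
  let p := if s then t else t^-1 in
  let c := if s then sqrt_t else sqrt_t^-1 in
  V (two_bridge (rcons b x))
  = p ^+ `|x|%N * V ((cups ++ braid b) ++ closing (~~ odd (size b)))
    - c * qint (- p) x * V (two_bridge b).
Proof.
move=> ebx s p c; have [eb x0 x2] := even_cf_rcons ebx.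
have rb := run_braid eb; rewrite -[in RHS](jones_smoothed eb).
rewrite two_bridgeE size_rcons braid_rcons catA -catA twistE.
(* The braid exponent, [x] or [- x], is opposite in sign to the last type entry. *)
have -> : (0 <= if odd (size b) then x else - x) = ~~ s.
  rewrite /s -signr_odd; case: (odd _) => /=; rewrite ?expr1 ?expr0; lia.
have -> : p = if ~~ s then t^-1 else t by rewrite if_neg.
have -> : c = if ~~ s then sqrt_t^-1 else sqrt_t by rewrite if_neg.
rewrite [odd _.+1]/=; case: (odd _).
  by apply: (@jones_twist _ _ [::] [:: true; false] true _ _ rb) => //;
    rewrite (is_link_cat _ rb).
by apply: (@jones_twist _ _ [:: true] [:: false] false _ _ rb) => //;
  rewrite (is_link_cat _ rb).
Qed.

Lemma jones_Vcf_pred (b : seq int) (x : int) :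
  Vcf V (rcons b x) ((size (rcons b x))%:Z - 1) = V (two_bridge b).
Proof.
rewrite size_rcons -addn1 PoszD addrK.
case: b => [|y b]; first by rewrite jones_empty.
by rewrite /= -cats1 take_size_cat.
Qed.

Lemma jones_Vcf_pred2 (b : seq int) (x : int) : even_cf b ->
  Vcf V (rcons b x) ((size (rcons b x))%:Z - 2)
  = V ((cups ++ braid b) ++ closing (~~ odd (size b))).
Proof.
(* For [b] empty the index is -1, and the convention is the value of two circles. *)
case/lastP: b => [_ | b y eb]; first by rewrite jones_unlink.
rewrite size_rcons [in odd _]size_rcons [odd _]/= negbK jones_untwisted // -(jones_Vcf_pred b y).
(* Both sides now have the same index, and the prefix read there does not reach [x]. *)
have -> : (size (rcons b y)).+1%:Z - 2 = (size (rcons b y))%:Z - 1 by lia.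
rewrite size_rcons -addn1 PoszD addrK.
case: {eb} (size b) (size_rcons b y) => //= n sz.
by rewrite -[in LHS]cats1 take_cat sz ltnS leqnn.
Qed.

End Jones.

Theorem theorem5p5 (V : diagram -> coef) (hV : is_jones V) :
  (forall (b : seq int) (m : nat) (bm : int),
     even_cf b -> m = size b -> (1 <= m)%N -> bm = last 0 b ->
     (last 0 (type_seq b) = -1 ->
        V (two_bridge b) = t ^ (- `|bm|) * Vcf V b (m%:Z - 2)
                           - sqrt_t^-1 * qint q `|bm| * Vcf V b (m%:Z - 1)) /\
     (last 0 (type_seq b) = 1 ->
        V (two_bridge b) = t ^ `|bm| * Vcf V b (m%:Z - 2)
                           - sqrt_t * qint qbar `|bm| * Vcf V b (m%:Z - 1))) /\
  (forall b1 : int, even_cf [:: b1] ->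
     (b1 < 0 ->
        V (two_bridge [:: b1]) = t ^ b1 * (- sqrt_t^-1 - sqrt_t)
                                 - sqrt_t^-1 * qint q (- b1)) /\
     (0 < b1 ->
        V (two_bridge [:: b1]) = t ^ b1 * (- sqrt_t^-1 - sqrt_t)
                                 - sqrt_t * qint qbar b1)).

Proof.
have half (A B : Prop) : A -> (A -> B) -> A /\ B by move=> a /(_ a).
apply: half => [b m bm | gen b1 eb].
  case/lastP: b => [_ -> // | b x] ebx -> _; rewrite last_rcons => ->.
  have [eb x0 _] := even_cf_rcons ebx.
  have -> : last 0 (type_seq (rcons b x)) = sgz ((-1) ^+ size b * x).
    rewrite /type_seq size_rcons /mkseq -[X in iota 0 X]addn1 iotaD map_cat.
    by rewrite last_cat /= nth_rcons ltnn eqxx sgzM sgzX sgzN1.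
  have qintN p : qint p `|x| = qint p x by rewrite /qint -abszE absz_nat.
  rewrite (jones_Vcf_pred hV) (jones_Vcf_pred2 hV) // jones_two_bridge_rcons //.
  rewrite !qintN -abszE -exprnN; split=> [/eqP | /eqP].
    by rewrite sgz_cp0 => s0; rewrite (lt_gtF s0) exprVn.
  by rewrite sgz_cp0 => ->.
(* With [m = 1] the indices are -1 and 0, so both [Vcf] values are the conventional ones. *)
have [neg pos] := gen [:: b1] 1%N b1 eb erefl erefl erefl.
split=> b10.
  rewrite neg /=; last by rewrite expr0 mul1r ltr0_sgz.
  by rewrite ltr0_norm // opprK mulr1.
rewrite pos /=; last by rewrite expr0 mul1r gtr0_sgz.
by rewrite gtr0_norm // mulr1.
Qed.
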